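(* Let $k$ be a positive integer and let $G$ be a $B+E_\ell$ graph with $$\ell<\binom{\lceil k/2\rceil}{2}+\binom{\lfloor k/2\rfloor}{2}=\frac{k^2-2k+\mathbf{1}_k}{4}.$$ Then $\mathrm{Kc}(G,k)=1$.
   Context: Graphs are finite and simple. For a positive integer $k$, a (proper) $k$-coloring of a graph $G$ assigns to each vertex a color from $\{1,\ldots,k\}$ so that adjacent vertices receive distinct colors (not all colors need be used). Given a $k$-coloring $\varphi$ and two distinct colors $i,j\in\{1,\ldots,k\}$, an $i,j$-Kempe swap interchanges the colors $i$ and $j$ on some connected component of the subgraph induced by the vertices colored $i$ or $j$ under $\varphi$; this yields another proper $k$-coloring. Two $k$-colorings of $G$ are equivalent if one can be transformed into the other by a (finite, possibly empty) sequence of Kempe swaps, all intermediate colorings being $k$-colorings. $\mathrm{Kc}(G,k)$ denotes the number of equivalence classes of $k$-colorings of $G$. A graph $G$ is a $B+E_\ell$ graph (written $G=B+E_\ell$), for a non-negative integer $\ell$, if it is formed from some bipartite graph $B$ by adding $\ell$ edges, i.e. $G$ has a bipartite spanning subgraph $B$ with $|E(G)|-|E(B)|=\ell$. For a positive integer $x$, $\mathbf{1}_x$ equals $1$ if $x$ is odd and $0$ if $x$ is even. *)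

(* Defs.v *)
From mathcomp Require Import all_boot all_order all_fingroup all_algebra.
Set Implicit Arguments.
Unset Strict Implicit.
Unset Printing Implicit Defensive.

(* The adjacency relation of a finite simple graph with vertex set T. *)
Definition simple_graph (T : finType) (e : rel T) : Prop :=
  symmetric e /\ irreflexive e.

Definition edges (T : finType) (e : rel T) : {set {set T}} :=
  [set [set p.1; p.2] | p : T * T & e p.1 p.2].

(* A is one of the two (possibly empty) parts of the bipartition. *)
Definition bipartite (T : finType) (e : rel T) : Prop :=
  exists A : {set T}, forall x y, e x y -> (x \in A) != (y \in A).

Definition BplusE (l : nat) (T : finType) (e : rel T) : Prop :=
  exists b : rel T,
    [/\ simple_graph b, bipartite b, subrel b e
      & #|edges e| = #|edges b| + l].

Section Kempe.

Variables (T : finType) (e : rel T) (k : nat).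

Definition proper_coloring (c : {ffun T -> 'I_k}) : bool :=
  [forall x, forall y, e x y ==> (c x != c y)].

Definition coloring := {c : {ffun T -> 'I_k} | proper_coloring c}.

Definition two_colored (c : {ffun T -> 'I_k}) (i j : 'I_k) : {set T} :=
  [set x | (c x == i) || (c x == j)].

(* The vertex set of the component of x in the subgraph induced by the
   vertices colored i or j, for x itself colored i or j. *)
Definition kempe_chain (c : {ffun T -> 'I_k}) (i j : 'I_k) (x : T) : {set T} :=
  [set y | connect [rel u v | [&& e u v, u \in two_colored c i j
                                & v \in two_colored c i j]] x y].

Definition kempe_swap (c : {ffun T -> 'I_k}) (i j : 'I_k) (x : T) :
    {ffun T -> 'I_k} :=
  [ffun y => if y \in kempe_chain c i j x then tperm i j (c y) else c y].

Definition kempe_step : rel coloring := fun c c' =>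
  [exists i : 'I_k, exists j : 'I_k, (i != j) &&
    [exists x in two_colored (val c) i j,
       val c' == kempe_swap (val c) i j x]].

Definition kempe_equiv : rel coloring := connect kempe_step.

Definition Kc : nat := #|equivalence_partition kempe_equiv [set: coloring]|.

End Kempe.

(* Main.v *)
Require Import Defs.
From mathcomp Require Import all_boot all_order all_fingroup all_algebra.
From mathcomp Require Import zify lra.
Set Implicit Arguments.
Unset Strict Implicit.
Unset Printing Implicit Defensive.

(** Let (A, ~A) be the bipartition of the bipartite subgraph.  The only edges
    that matter are the same-side edges, those inside A or inside ~A: there are
    at most l of them.  With p + q = k the two halves of k, the hypothesis says
    that l < C(p, 2) + C(q, 2) = C(k, 2) - p q.

    Call a color mixed if it occurs both on A and on ~A, and a coloring split if
    it has no mixed color.  The argument brings every coloring to a split one,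
    and then connects all split colorings.

    Reaching a split coloring.  If no same-side edge joins colors i and j, a
    single Kempe change turns i and j into i on A and into j on ~A.  Suppose
    that some color is mixed and that no such change makes progress.  Then every
    pair of colors is joined by a same-side edge, except those made of an A-only
    and a ~A-only color.  If there are s1 and s2 colors of these two kinds, that
    takes at least C(k, 2) - s1 s2 same-side edges, too many since s1 s2 <= p q
    ([sorting_pair], [reach_some_split]).

    Connecting split colorings.  Let G1 and G2 be the graphs induced on A and
    ~A, and choose mi with C(mi, 2) <= |E(Gi)| < C(mi + 1, 2).  A graph with
    fewer than C(m + 1, 2) edges is (m - 1)-degenerate, so it is m-colorable
    and, by the theorem of Las Vergnas and Meyniel, its colorings with any m or
    more colors are all equivalent ([colorable], [recolor]).  In a split coloring
    the two sides are recolored independently.  Convexity gives m1 + m2 < k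
    ([balanced_minimum]), so there is always a spare color, which can be moved
    from one side to the other; this connects the split colorings for all ways
    of sharing out the colors ([roomy_connect]). *)

(** * Arithmetic of the bound *)

Lemma balanced_product n x y : x + y <= n -> x * y <= uphalf n * n./2.
Proof.
move=> lexy; have le_sq := leq_mul lexy lexy.
have le4 : 4 * (x * y) <= (x + y) * (x + y) by rewrite mulnn; apply: nat_AGM2.
have := leq_trans le4 le_sq; rewrite uphalf_half.
move: (odd_double_half n); rewrite -muln2; move: (x * y) (n./2) => q h.
by case: (odd n) => /= <-; rewrite ?add0n ?add1n; lia.
Qed.

(** With n twice the number of edges of a graph, m is the largest size of a
    complete graph with at most that many edges. *)
Lemma triangular_window n : exists m, (m * m.-1 <= n) && (n < m * m.+1).
Proof.
have ex : exists m, n < m * m.+1 by exists n.+1; nia.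
exists (ex_minn ex); case: ex_minnP => m lt_n min_m; rewrite lt_n andbT.
case: m => [//|m] in lt_n min_m *; rewrite leqNgt mulnC /=.
by apply/negP=> /min_m; rewrite ltnn.
Qed.

Lemma pairs_halves n :
  n * n.-1 = 2 * (uphalf n * n./2) + 2 * ((uphalf n).-1 * n./2).
Proof.
rewrite uphalf_half -{1 2}(odd_double_half n) -muln2; case: (odd n) => /=.
  by rewrite add1n /=; lia.
by rewrite !add0n; case: (n./2) => [|h] //=; lia.
Qed.

Lemma double_bin2 n : 2 * 'C(n, 2) = n * n.-1.
Proof. by rewrite mulnC -[2 in LHS]/(2`!) bin_ffact ffactnS ffactn1. Qed.

Lemma sum_bin2_halves n :
  'C(uphalf n, 2) + 'C(n./2, 2) = (uphalf n).-1 * n./2.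
Proof.
suff : 2 * ('C(uphalf n, 2) + 'C(n./2, 2)) = 2 * ((uphalf n).-1 * n./2) by lia.
rewrite mulnDr !double_bin2 uphalf_half.
by case: (odd n); rewrite ?add0n ?add1n /=; [case: (n./2) => [|h] /=|]; lia.
Qed.

(** Convexity: C(m1, 2) + C(m2, 2), for m1 + m2 given, is least at the balanced
    partition, and that least value is monotone in the sum. *)
Lemma balanced_minimum n m1 m2 : n <= m1 + m2 ->
  2 * ('C(uphalf n, 2) + 'C(n./2, 2)) <= m1 * m1.-1 + m2 * m2.-1.
Proof.
move=> le_n; rewrite sum_bin2_halves.
have le_prod := balanced_product (leqnn (m1 + m2)).
have mono : (uphalf n).-1 * n./2 <= (uphalf (m1 + m2)).-1 * (m1 + m2)./2.
  by rewrite leq_mul ?half_leq // -!subn1 leq_sub2r // uphalf_leq.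
have split_sum : (m1 + m2) * (m1 + m2).-1 =
    m1 * m1.-1 + m2 * m2.-1 + 2 * (m1 * m2).
  case: m1 {le_n le_prod mono} => [|m1]; first by rewrite !add0n muln0 addn0.
  case: m2 => [|m2]; first by rewrite !addn0 !muln0 !addn0.
  by rewrite addSn addnS !succnK; lia.
have := pairs_halves (m1 + m2); lia.
Qed.

(** * Kempe changes on closed sets *)

Section KempeChanges.

Variables (T : finType) (e : rel T) (k : nat).
Hypotheses (e_sym : symmetric e) (e_irr : irreflexive e).
Notation col := {ffun T -> 'I_k}.
Implicit Types (c d : col) (i j : 'I_k) (K X Y A : {set T}) (F S : {set 'I_k}).

Definition proper_on X c : Prop :=
  forall x y, x \in X -> y \in X -> e x y -> c x != c y.

Lemma proper_onT c : reflect (proper_on setT c) (proper_coloring e c).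
Proof.
apply: (iffP forallP) => [pc x y _ _ exy | pc x].
  by move/forallP/(_ y): (pc x); rewrite exy.
by apply/forallP=> y; apply/implyP=> exy; apply: pc.
Qed.

Definition swap c i j K : col :=
  [ffun x => if x \in K then tperm i j (c x) else c x].

Lemma swapE c i j K x :
  swap c i j K x = if x \in K then tperm i j (c x) else c x.
Proof. exact: ffunE. Qed.

(** The trace of K on the vertices of X colored i or j is a union of components
    of the graph they induce.  Vertices of K of other colors are harmless, as
    the swap leaves them alone.  Working with unions avoids any computation of
    components: recoloring arguments only have to exhibit a closed set. *)
Definition kempe_closed X c i j K : Prop :=
  K \subset X /\
  forall x y, x \in K -> y \in X -> e x y ->
    x \in two_colored c i j -> y \in two_colored c i j -> y \in K.

Lemma tperm_two i j (a : 'I_k) :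
  (tperm i j a == i) || (tperm i j a == j) = (a == i) || (a == j).
Proof. by case: tpermP => [->|->|//]; rewrite !eqxx ?orbT. Qed.

Lemma two_colored_swap c i j K :
  two_colored (swap c i j K) i j = two_colored c i j.
Proof.
by apply/setP=> x; rewrite !inE ffunE; case: ifP => // _; apply: tperm_two.
Qed.

Lemma tperm_off i j x c : x \notin two_colored c i j -> tperm i j (c x) = c x.
Proof. by rewrite inE negb_or => /andP[ni nj]; rewrite tpermD // eq_sym. Qed.

Lemma swap_involutive c i j K : swap (swap c i j K) i j K = c.
Proof.
by apply/ffunP=> x; rewrite !swapE; case: (x \in K); rewrite ?tpermK.
Qed.

Lemma swap_proper X c i j K :
  proper_on X c -> kempe_closed X c i j K -> proper_on X (swap c i j K).
Proof.
move=> pc [_ clK].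
suff half x y : x \in X -> y \in X -> e x y -> x \in K -> y \notin K ->
    tperm i j (c x) != c y.
  move=> x y xX yX exy; rewrite !ffunE.
  case: ifP => xK; case: ifP => yK.
  - by rewrite (inj_eq perm_inj) pc.
  - by apply: half => //; rewrite yK.
  - by rewrite eq_sym; apply: half => //; rewrite ?xK // e_sym.
  - exact: pc.
move=> xX yX exy xK yNK.
have [x2|/tperm_off->] := boolP (x \in two_colored c i j); last exact: pc.
apply: contra yNK => /eqP cy; apply: (clK x) => //.
by rewrite inE -cy tperm_two; rewrite inE in x2.
Qed.

(** Sequences of changes of G[X] with colors in F; only edges inside X restrict
    the closed sets, and the colors off X never change.  Taking i = j is allowed
    and does nothing, which saves case distinctions. *)
Inductive reach X F : col -> col -> Prop :=
| reach_refl c : reach X F c c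
| reach_swap c i j K d :
    i \in F -> j \in F -> kempe_closed X c i j K ->
    reach X F (swap c i j K) d -> reach X F c d.

Lemma reach1 X F c i j K : i \in F -> j \in F -> kempe_closed X c i j K ->
  reach X F c (swap c i j K).
Proof. by move=> iF jF clK; apply: reach_swap clK (reach_refl _ _ _). Qed.

Lemma reach_trans X F c1 c2 c3 :
  reach X F c1 c2 -> reach X F c2 c3 -> reach X F c1 c3.
Proof.
elim=> // c i j K d iF jF clK _ IH /IH; exact: reach_swap.
Qed.

(** A change does not alter the set of vertices colored i or j, so performing it
    again is allowed, and undoes it. *)
Lemma reach_sym X F c d : reach X F c d -> reach X F d c.
Proof.
elim=> [*|{}c i j K {}d iF jF [KX clK] _ IH]; first exact: reach_refl.
apply: reach_trans IH _; rewrite -{2}(swap_involutive c i j K).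
by apply: reach1 => //; split=> // x y; rewrite two_colored_swap; apply: clK.
Qed.

Lemma reach_proper X F c d : reach X F c d -> proper_on X c -> proper_on X d.
Proof. by elim=> // {}c i j K {}d _ _ clK _ IH /swap_proper/(_ clK)/IH. Qed.

Lemma kempe_chain_sub c i j x K : kempe_closed setT c i j K -> x \in K ->
  kempe_chain e c i j x \subset K.
Proof.
move=> [_ clK] xK; apply/subsetP=> y; rewrite inE => /connectP[p].
elim: p x xK => [|z p IH] x xK /= => [_ -> // | /andP[/and3P[exz x2 z2] pz]].
by apply: IH pz; apply: (clK x).
Qed.

Lemma kempe_chain_closed c i j x :
  kempe_closed setT c i j (kempe_chain e c i j x).
Proof.
split=> [|y z]; first exact: subsetT.
rewrite !inE => xy _ eyz y2 z2; apply: connect_trans xy (connect1 _).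
by rewrite /= eyz !inE y2 z2.
Qed.

(** Peel off the Kempe chain of one vertex of K colored i or j: the chain lies
    in K, and the rest of K is still closed after the chain is swapped. *)
Lemma closed_swap_kempe (c d : coloring e k) i j K :
  kempe_closed setT (val c) i j K -> val d = swap (val c) i j K ->
  kempe_equiv c d.
Proof.
have [n] := ubnP #|K :&: two_colored (val c) i j|.
elim: n => // n IH in c K *; rewrite ltnS => leKn clK def_d.
have idle : swap (val c) i j K = val c -> kempe_equiv c d.
  by rewrite -def_d => /val_inj->; apply: connect0.
have [ij|ij] := eqVneq i j.
  by apply: idle; apply/ffunP=> x; rewrite ffunE ij tperm1 perm1 if_same.
have [K0|[x]] := set_0Vmem (K :&: two_colored (val c) i j).
  apply: idle; apply/ffunP=> x; rewrite ffunE; case: ifP => // xK.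
  apply: tperm_off; apply/negP=> x2.
  by move/setP/(_ x): K0; rewrite in_setI xK x2 inE.
rewrite in_setI => /andP[xK x2].
set C := kempe_chain e (val c) i j x.
have xC : x \in C by rewrite inE.
have CK : C \subset K by apply: kempe_chain_sub.
have clC : kempe_closed setT (val c) i j C by apply: kempe_chain_closed.
have pC : proper_coloring e (swap (val c) i j C).
  by apply/proper_onT/swap_proper => //; apply/proper_onT/(valP c).
apply: connect_trans (connect1 _) (IH (Sub _ pC) (K :\: C) _ _ _).
- apply/existsP; exists i; apply/existsP; exists j; rewrite ij /=.
  by apply/existsP; exists x; rewrite x2 /=.
- rewrite two_colored_swap (leq_trans _ leKn) // proper_card //.
  apply/properP; split; first by rewrite setSI // subsetDl.
  exists x; first by rewrite in_setI xK.
  by rewrite in_setI negb_and in_setD xC.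
- split=> [|y z]; first exact: subsetT.
  rewrite two_colored_swap => /setDP[yK yNC] zT eyz y2 z2.
  rewrite in_setD (clK.2 y) // andbT; apply: contra yNC => zC.
  by apply: (clC.2 z); rewrite // e_sym.
rewrite def_d; apply/ffunP=> y; rewrite !swapE in_setD.
by case: (boolP (y \in C)) => //= /(subsetP CK) ->.
Qed.

Lemma reach_kempe (c d : coloring e k) :
  reach setT setT (val c) (val d) -> kempe_equiv c d.
Proof.
move Ec: (val c) => c0; move Ed: (val d) => d0 r.
elim: r c Ec Ed => [c1 c Ec Ed | {}c0 i j K {}d0 _ _ clK _ IH c Ec Ed].
  by rewrite (val_inj (etrans Ec (esym Ed))); apply: connect0.
have pK : proper_coloring e (swap c0 i j K).
  by apply/proper_onT/swap_proper => //; rewrite -Ec; apply/proper_onT/(valP c).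
apply: connect_trans (IH (Sub _ pK) erefl Ed).
apply: (@closed_swap_kempe _ _ i j K).
  by rewrite Ec.
by rewrite Ec SubK.
Qed.

(** * Degenerate graphs: the theorem of Las Vergnas and Meyniel *)

Definition nbrs Y v := [set u in Y | e v u].

(** Twice the number of edges of G[X]. *)
Definition degsum X := \sum_(x in X) #|nbrs X x|.

Lemma degsum_mono X Y : Y \subset X -> degsum Y <= degsum X.
Proof.
move=> YX; rewrite /degsum [leqRHS](big_setID Y) /= (setIidPr YX).
apply: leq_trans (leq_addr _ _); apply: leq_sum => x _.
by apply/subset_leq_card/subsetP=> y; rewrite !inE => /andP[/(subsetP YX)-> ->].
Qed.

(** If all degrees in G[X] were at least m, then X would contain a vertex and m
    neighbors of it, hence m + 1 vertices of degree at least m. *)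
Lemma low_degree_vertex X m : X != set0 -> degsum X < m * m.+1 ->
  exists2 v, v \in X & #|nbrs X v| < m.
Proof.
move=> /set0Pn[v vX] ltX; apply/exists_inP; apply: contraLR ltX.
rewrite negb_exists_in -leqNgt => /forall_inP big.
have dX x : x \in X -> m <= #|nbrs X x| by move/big; rewrite -leqNgt.
have ltdX : m < #|X|.
  rewrite (cardsD1 v) vX ltnS (leq_trans (dX v vX)) //.
  apply/subset_leq_card/subsetP=> u; rewrite !inE => /andP[-> evu].
  by rewrite andbT; apply: contraTneq evu => ->; rewrite e_irr.
rewrite mulnC (leq_trans (leq_mul ltdX (leqnn m))) // -sum_nat_const.
exact: leq_sum.
Qed.

(** The form in which degeneracy is used: the edge bound passes to subsets, so
    X can be built by adding vertices that have fewer than m neighbors among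
    those already present. *)
Lemma degenerate_ind m (P : {set T} -> Prop) :
  P set0 ->
  (forall Y v, v \notin Y -> #|nbrs Y v| < m -> P Y -> P (v |: Y)) ->
  forall X, degsum X < m * m.+1 -> P X.
Proof.
move=> P0 PS X; have [n] := ubnP #|X|; elim: n => // n IH in X *.
rewrite ltnS => leX ltX; have [->//|nX] := eqVneq X set0.
have [v vX ltv] := low_degree_vertex nX ltX.
rewrite -(setD1K vX); apply: PS; first by rewrite setD11.
  apply: leq_ltn_trans ltv; apply/subset_leq_card/subsetP=> u.
  by rewrite !inE => /andP[/andP[_ ->] ->].
apply: IH; last exact: leq_ltn_trans (degsum_mono (subD1set _ _)) ltX.
by apply: leq_trans leX; rewrite [leqRHS](cardsD1 v) vX.
Qed.

Definition colored_in X F c := forall x, x \in X -> c x \in F.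

Lemma free_color Y v c F : #|nbrs Y v| < #|F| ->
  exists2 f, f \in F & forall u, u \in Y -> e v u -> c u != f.
Proof.
move=> ltF; have: ~~ (F \subset [set c u | u in nbrs Y v]).
  apply: contraTN ltF => /subset_leq_card leF; rewrite -leqNgt.
  exact: leq_trans leF (leq_imset_card _ _).
case/subsetPn=> f fF fN; exists f => // u uY evu.
by apply: contraNneq fN => <-; apply/imsetP; exists u; rewrite // inE uY.
Qed.

Lemma colorable m X F : degsum X < m * m.+1 -> m <= #|F| -> 0 < k ->
  exists2 c, proper_on X c & colored_in X F c.
Proof.
move=> ltX leF k0; move: X ltX.
apply: degenerate_ind => [|Y v vY ltv [c pc cF]].
  by exists [ffun=> Ordinal k0] => x; rewrite inE.
have [f fF fN] := free_color c (leq_trans ltv leF).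
exists [ffun x => if x == v then f else c x].
  move=> x y; rewrite !in_setU1 !ffunE.
  case: eqVneq => [->|_]; case: eqVneq => [->|_] //=; rewrite ?e_irr //.
  - by move=> _ yY evy; rewrite eq_sym; apply: fN.
  - by move=> xY _; rewrite e_sym; apply: fN.
  - exact: pc.
by move=> x; rewrite in_setU1 ffunE; case: eqVneq => //= _; apply: cF.
Qed.

Lemma swap1 c v f :
  swap c (c v) f [set v] = [ffun x => if x == v then f else c x].
Proof.
by apply/ffunP=> x; rewrite !ffunE inE; case: eqVneq => // ->; rewrite tpermL.
Qed.

Lemma recolor_closed Y v c f : proper_on (v |: Y) c ->
  (forall u, u \in Y -> e v u -> c u != f) ->
  kempe_closed (v |: Y) c (c v) f [set v].
Proof.
move=> pc fN; split=> [|x y]; first by rewrite sub1set setU11.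
rewrite in_set1 => /eqP-> /setU1P[->|yY] evy; first by rewrite e_irr in evy.
move=> _; rewrite !inE (negPf (fN _ yY evy)) orbF eq_sym => /eqP cvy.
by have := pc v y (setU11 _ _) (setU1r _ yY) evy; rewrite cvy eqxx.
Qed.

Lemma eq_closed X c c' i j K : {in X, c =1 c'} ->
  kempe_closed X c i j K -> kempe_closed X c' i j K.
Proof.
move=> eqc [KX clK]; split=> // x y xK yX exy.
have := clK x y xK yX exy.
by rewrite !inE !eqc // (subsetP KX).
Qed.

(** Changes on Y are followed on Y + v, whose extra vertex v has fewer than |F|
    neighbors.  A closed set K of Y may be used as it is, or with v added, unless
    v is colored i or j and has two neighbors of the other of these colors, one
    in K and one not.  Then the neighbors of v show at most |F| - 2 colors, so
    some color of F is neither shown by them nor that of v.  It differs from i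
    and j, and once v has been given that color, K may be used as it is. *)
Lemma reach_lift F Y v c c' d : v \notin Y -> #|nbrs Y v| < #|F| ->
  reach Y F c c' ->
  {in Y, d =1 c} -> proper_on (v |: Y) d -> colored_in (v |: Y) F d ->
  exists d', [/\ reach (v |: Y) F d d', {in Y, d' =1 c'},
                 proper_on (v |: Y) d' & colored_in (v |: Y) F d'].
Proof.
move=> vY ltv r; elim: r d => [{}c d eqd pd dF|].
  by exists d; split=> //; apply: reach_refl.
move=> {}c i j K {}c' iF jF clK _ IH d eqd pd dF.
have KY : K \subset Y by case: clK.
have vNK : v \notin K by apply: contra vY; apply: (subsetP KY).
suff [d1 [K1 [[r1 eq1 dF1] cl1 eqK]]] : exists d1, exists K1,
    [/\ [/\ reach (v |: Y) F d d1, {in Y, d1 =1 d} & d1 v \in F],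
       kempe_closed (v |: Y) d1 i j K1 & K1 :\ v = K].
  have r2 : reach (v |: Y) F d (swap d1 i j K1).
    exact: reach_trans r1 (reach1 iF jF cl1).
  have [|||d' [r3 eqd' pd' dF']] := IH (swap d1 i j K1).
  - move=> x xY; rewrite !swapE eq1 // eqd // -eqK !inE.
    by case: eqVneq xY vY => // -> ->.
  - exact: (reach_proper r2).
  - move=> x xX; have d1F : d1 x \in F.
      by case/setU1P: xX => [->//|xY]; rewrite eq1 // dF // setU1r.
    by rewrite swapE; case: ifP => // _; case: tpermP.
  by exists d'; split=> //; apply: reach_trans r2 r3.
(* It remains to recolor v, if needed, and to extend K to a closed set K1. *)
have clKd : kempe_closed Y d i j K by apply: eq_closed clK => x /eqd.
have KX : K \subset v |: Y := subset_trans KY (subsetUr _ _).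
have off d1 : {in Y, d1 =1 d} -> v \notin two_colored d1 i j ->
    kempe_closed (v |: Y) d1 i j K.
  move=> eq1 v2; split=> // x y xK /setU1P[->|yY] exy x2 y2.
    by rewrite y2 in v2.
  have [_ cl] : kempe_closed Y d1 i j K by apply: eq_closed clKd => z /eq1.
  exact: (cl x).
have K1v : K :\ v = K.
  by apply/setP=> x; rewrite !inE; case: eqVneq vNK => // -> /negPf->.
have dvF : d v \in F by rewrite dF ?setU11.
have [v2|v2] := boolP (v \in two_colored d i j); last first.
  by exists d, K; split=> //; [split=> //; apply: reach_refl | apply: off].
pose N := nbrs Y v :&: two_colored d i j.
have [/eqP N0|/set0Pn[u]] := boolP (N :&: K == set0).
  exists d, K; split=> //; first by split=> //; apply: reach_refl.
  split=> // x y xK /setU1P[->|yY] exy x2 y2; last exact: (clKd.2 x).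
  suff : x \in N :&: K by rewrite N0 inE.
  by rewrite in_setI xK andbT in_setI x2 andbT inE (subsetP KY) // e_sym.
rewrite in_setI => /andP[/setIP[]]; rewrite inE => /andP[uY evu] u2 uK.
have [/subsetP NK|/subsetPn[w]] := boolP (N \subset K).
  exists d, (v |: K); split; first by split=> //; apply: reach_refl.
    split=> [|x y]; first by rewrite setUS.
    case/setU1P=> [->|xK] /setU1P[->|yY] exy x2 y2; rewrite ?setU11 //.
      by apply/setU1P; right; apply: NK; rewrite !in_setI y2 inE yY exy.
    by apply/setU1P; right; apply: (clKd.2 x).
  by rewrite setU1K.
rewrite in_setI => /andP[]; rewrite inE => /andP[wY evw] w2 wNK.
have vX : v \in v |: Y := setU11 _ _.
(* The neighbors u in K and w off K share the one of i, j that v lacks. *)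
have duw : d u = d w.
  have := pd v u vX (setU1r _ uY) evu; have := pd v w vX (setU1r _ wY) evw.
  move: v2 u2 w2; rewrite !inE.
  by do 3 case/orP=> /eqP->; rewrite ?eqxx.
have ltN : #|nbrs (Y :\ u) v| < #|F :\ d v|.
  have uN : u \in nbrs Y v by rewrite inE uY.
  rewrite (cardsD1 (d v) F) dvF (cardsD1 u) uN !add1n ltnS in ltv.
  apply: leq_ltn_trans ltv; apply/subset_leq_card/subsetP=> z.
  by rewrite !inE andbA.
have [f /setD1P[fdv fF] fN] := free_color d ltN.
have {}fN z : z \in Y -> e v z -> d z != f.
  move=> zY evz; have [->|zu] := eqVneq z u; last by rewrite fN // !inE zu.
  by rewrite duw fN // !inE wY andbT; apply: contraNneq wNK => ->.
have fnij : f \notin pred2 i j.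
  have := fN u uY evu; have := pd v u vX (setU1r _ uY) evu.
  move: v2 u2 fdv; rewrite !inE negb_or.
  by do 2 case/orP=> /eqP->; rewrite ?eqxx // => -> _; rewrite eq_sym => ->.
exists (swap d (d v) f [set v]), K; split=> //.
  split; first by apply: reach1; last exact: recolor_closed.
    by move=> x xY; rewrite swap1 ffunE; case: eqVneq xY vY => // -> ->.
  by rewrite swap1 ffunE eqxx.
apply: off; last by rewrite inE swap1 ffunE eqxx.
by move=> x xY; rewrite swap1 ffunE; case: eqVneq xY vY => // -> ->.
Qed.

(** Any two F-colorings of G[X] are connected: in the induction step, follow the
    changes on Y that make the colorings agree there, and recolor v last. *)
Lemma recolor m X F c c' : degsum X < m * m.+1 -> m <= #|F| ->
  proper_on X c -> colored_in X F c -> proper_on X c' -> colored_in X F c' ->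
  exists c'', reach X F c c'' /\ {in X, c'' =1 c'}.
Proof.
move=> ltX leF; move: X ltX; apply: degenerate_ind => [|Y v vY ltv IH].
  by move=> *; exists c; split=> [|x]; [apply: reach_refl | rewrite inE].
have YX : {subset Y <= v |: Y} by apply/subsetP/subsetUr.
move=> pc cF pc' cF'.
have [|||| c1 [r1 eq1]] := IH.
- by move=> x y /YX xX /YX; apply: pc.
- by move=> x /YX; apply: cF.
- by move=> x y /YX xX /YX; apply: pc'.
- by move=> x /YX; apply: cF'.
have [//|d1 [r2 eq2 pd1 dF1]] := reach_lift vY (leq_trans ltv leF) r1 _ pc cF.
exists (swap d1 (d1 v) (c' v) [set v]); split.
  apply: reach_trans r2 (reach1 _ _ _); rewrite ?dF1 ?cF' ?setU11 //.
  apply: recolor_closed => // u uY evu.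
  by rewrite eq2 // eq1 // eq_sym pc' ?setU11 ?YX.
move=> x; rewrite in_setU1 swap1 ffunE.
by case: eqVneq => [-> //|_ /= xY]; rewrite eq2 // eq1.
Qed.

(** * Split colorings *)

(** S is a set of colors reserved for A; it may contain colors that do not
    occur. *)
Definition split A S c := forall x, (c x \in S) = (x \in A).

Lemma splitC A S c : split A S c -> split (~: A) (~: S) c.
Proof. by move=> sc x; rewrite !in_setC sc. Qed.

(** The colors of S do not occur off A, so changes inside A with colors in S are
    changes of the whole graph. *)
Lemma reach_split A S c d : split A S c -> reach A S c d ->
  reach setT setT c d /\ {in ~: A, d =1 c}.
Proof.
move=> sc r; elim: r sc => [{}c _|{}c i j K {}d iS jS [KA clK] _ IH sc].
  by split=> //; apply: reach_refl.
have offK x : x \notin A -> x \notin K by apply: contra; apply: (subsetP KA).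
have [|r eqd] := IH.
  move=> x; rewrite swapE; case: ifP => // /(subsetP KA) xA.
  by rewrite xA; case: tpermP; rewrite ?iS ?jS // sc.
split; last first.
  by move=> x xA; rewrite eqd // swapE ifN // offK // -in_setC.
apply: reach_swap r; rewrite ?inE //; split=> [|x y xK _ exy x2 y2].
  exact: subsetT.
apply: (clK x) => //; rewrite -sc.
by move: y2; rewrite inE => /orP[]/eqP->.
Qed.

Lemma split_recolor m A S c c' : degsum A < m * m.+1 -> m <= #|S| ->
  proper_on setT c -> split A S c -> proper_on A c' -> colored_in A S c' ->
  exists d, [/\ reach setT setT c d, {in A, d =1 c'} & {in ~: A, d =1 c}].
Proof.
move=> ltA leS pc sc pc' cS'.
have pcA : proper_on A c by move=> x y _ _; apply: pc; rewrite inE.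
have cS : colored_in A S c by move=> x; rewrite sc.
have [d [r eqd]] := recolor ltA leS pcA cS pc' cS'.
by have [r' eqd'] := reach_split sc r; exists d.
Qed.

Lemma split_reach m1 m2 A S c c' :
  degsum A < m1 * m1.+1 -> degsum (~: A) < m2 * m2.+1 ->
  m1 <= #|S| -> m2 <= #|~: S| ->
  proper_on setT c -> split A S c -> proper_on setT c' -> split A S c' ->
  reach setT setT c c'.
Proof.
move=> lt1 lt2 le1 le2 pc sc pc' sc'.
have pX' X : proper_on X c' by move=> x y _ _; apply: pc'; rewrite inE.
have [|d [r eqA eqN]] := split_recolor lt1 le1 pc sc (pX' A).
  by move=> x; rewrite sc'.
have sd : split A S d.
  move=> x; case: (boolP (x \in A)) => xA; first by rewrite eqA // sc' xA.
  by rewrite eqN ?in_setC // sc (negPf xA).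
have [|d' [r' eqN' eqA']] :=
  split_recolor lt2 le2 (reach_proper r pc) (splitC sd) (pX' _).
  by move=> x; rewrite !in_setC sc'.
rewrite (_ : c' = d'); first exact: reach_trans r'.
apply/ffunP=> x; case: (boolP (x \in A)) => xA; last by rewrite eqN' ?in_setC.
by rewrite eqA' ?setCK // eqA.
Qed.

(** If A can be colored with few colors, the other colors of S can be handed
    over to the complement. *)
Lemma split_shrink m A S S1 c : degsum A < m * m.+1 -> m <= #|S1| ->
  S1 \subset S -> 0 < k -> proper_on setT c -> split A S c ->
  exists2 d, reach setT setT c d & split A S1 d.
Proof.
move=> ltA le1 S1S k0 pc sc.
have [c1 pc1 cS1] := colorable ltA le1 k0.
have leS := leq_trans le1 (subset_leq_card S1S).
have [|d [r eqA eqN]] := split_recolor ltA leS pc sc pc1.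
  by move=> x /cS1; apply: (subsetP S1S).
exists d => // x; case: (boolP (x \in A)) => xA; first by rewrite eqA // cS1.
rewrite eqN ?in_setC //; apply/negP => /(subsetP S1S).
by rewrite sc (negPf xA).
Qed.

Lemma card_setC_ord S : #|S| + #|~: S| = k.
Proof. by rewrite cardsC card_ord. Qed.

Lemma subset_of_card m S : m <= #|S| ->
  exists2 S1 : {set 'I_k}, S1 \subset S & #|S1| = m.
Proof.
move=> lemS; have: 0 < #|[set S1 : {set 'I_k} | S1 \subset S & #|S1| == m]|.
  by rewrite cards_draws bin_gt0.
by case/card_gt0P=> S1; rewrite inE => /andP[sub /eqP card1]; exists S1.
Qed.

(** * Moving colors between the two sides *)

Section Connect.

Variables (A : {set T}) (m1 m2 : nat).
Hypotheses (ltA : degsum A < m1 * m1.+1) (ltNA : degsum (~: A) < m2 * m2.+1).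
Hypothesis (lt_k : m1 + m2 < k).

(** S has enough colors for A, and its complement enough for ~A. *)
Definition roomy S := (m1 <= #|S|) && (#|S| + m2 <= k).

Lemma roomy_sizes S : roomy S -> m1 <= #|S| /\ m2 <= #|~: S|.
Proof.
by case/andP=> le1 le2; split=> //; rewrite -(leq_add2l #|S|) card_setC_ord.
Qed.

Lemma roomy_reach S c c' : roomy S -> proper_on setT c -> split A S c ->
  proper_on setT c' -> split A S c' -> reach setT setT c c'.
Proof. by case/roomy_sizes=> le1 le2; apply: (split_reach ltA ltNA). Qed.

Lemma split_coloring S S' : S \subset S' -> roomy S -> roomy S' ->
  exists c, [/\ proper_on setT c, split A S c & split A S' c].
Proof.
move=> SS' /roomy_sizes[le1 _] /roomy_sizes[_ le2].
have k0 : 0 < k by apply: leq_trans lt_k.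
have [c1 pc1 cS1] := colorable ltA le1 k0.
have [c2 pc2 cS2] := colorable ltNA le2 k0.
pose c : col := [ffun x => if x \in A then c1 x else c2 x].
have cE x : c x = if x \in A then c1 x else c2 x by apply: ffunE.
have cS2' x : x \notin A -> c2 x \notin S'.
  by move=> xA; have := cS2 x; rewrite !in_setC; apply.
have sc : split A S c.
  move=> x; rewrite cE; case: (boolP (x \in A)) => xA; first exact: cS1.
  by apply: contraNF (cS2' x xA); apply: (subsetP SS').
exists c; split=> //.
  move=> x y _ _ exy.
  have [xy|xy] := eqVneq (x \in A) (y \in A); last first.
    by apply: contraNneq xy => cxy; rewrite -!sc cxy.
  rewrite !cE xy; case: ifP => yA; first by apply: pc1; rewrite // xy.
  by apply: pc2; rewrite // in_setC ?xy yA.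
move=> x; rewrite cE; case: (boolP (x \in A)) => xA; last exact/negbTE/cS2'.
by apply: (subsetP SS'); apply: cS1.
Qed.

(** A coloring that uses on A the smaller set S, and on ~A the smaller set ~S',
    is split by both S and S', and links the two classes. *)
Lemma nested_reach S S' c c' : S \subset S' -> roomy S -> roomy S' ->
  proper_on setT c -> split A S c -> proper_on setT c' -> split A S' c' ->
  reach setT setT c c'.
Proof.
move=> SS' gS gS' pc sc pc' sc'.
have [c0 [pc0 sc0 sc0']] := split_coloring SS' gS gS'.
by apply: (reach_trans (c2 := c0));
  [apply: (@roomy_reach S)|apply: (@roomy_reach S')].
Qed.

(** Shift S towards S' one color at a time, adding a color of S' while ~S has a
    spare one.  When it has none, m1 + m2 < k makes S have a spare one. *)
Lemma roomy_connect S S' c c' : roomy S -> roomy S' ->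
  proper_on setT c -> split A S c -> proper_on setT c' -> split A S' c' ->
  reach setT setT c c'.
Proof.
have [n] := ubnP (#|S :\: S'| + #|S' :\: S|).
elim: n => // n IH in S c *; rewrite ltnS => len gS gS' pc sc pc' sc'.
have [S'S|/subsetPn[y yS' yS]] := boolP (S' \subset S).
  by apply: reach_sym; apply: nested_reach S'S _ _ _ _ _ _.
have [le1 le2] := andP gS; have [le1' le2'] := andP gS'.
move: le2; rewrite leq_eqVlt => /orP[/eqP eqk|ltk].
  have [x xS xS'] : exists2 x, x \in S & x \notin S'.
    apply/subsetPn; apply: contra yS => SS'.
    suff /eqP-> : S == S' by [].
    by rewrite eqEcard SS' -(leq_add2r m2) eqk.
  have cS := cardsD1 x S; rewrite xS in cS.
  have gS1 : roomy (S :\ x) by rewrite /roomy; lia.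
  have [c0 [pc0 sc0 sc0']] := split_coloring (subD1set S x) gS1 gS.
  apply: (reach_trans (c2 := c0)); first exact: (@roomy_reach S).
  apply: IH gS1 gS' pc0 sc0 pc' sc'; apply: leq_trans len.
  rewrite -addSn (cardsD1 x (S :\: S')) inE xS xS' add1n.
  apply: leq_add; first by rewrite ltnS subset_leq_card // setDDl setUC -setDDl.
  apply/subset_leq_card/subsetP=> z; rewrite !inE negb_and negbK.
  by case/andP=> /orP[/eqP->|->//]; rewrite (negPf xS').
have cS := cardsU1 y S; rewrite yS in cS.
have gS1 : roomy (y |: S) by rewrite /roomy; lia.
have [c0 [pc0 sc0 sc0']] := split_coloring (subsetUr [set y] S) gS gS1.
apply: (reach_trans (c2 := c0)); first exact: (@roomy_reach S).
apply: IH gS1 gS' pc0 sc0' pc' sc'; apply: leq_trans len.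
rewrite -addnS (cardsD1 y (S' :\: S)) inE yS yS' add1n.
apply: leq_add; last by rewrite ltnS subset_leq_card // setDDl setUC.
apply/subset_leq_card/subsetP=> z; rewrite !inE.
by case/andP=> zS' /orP[/eqP zy|->]; [rewrite zy yS' in zS' | rewrite zS'].
Qed.

(** As m1 + m2 < k, at most one side is short of colors, and then the other one
    can spare some. *)
Lemma split_roomy S c : proper_on setT c -> split A S c ->
  exists d S', [/\ reach setT setT c d, split A S' d & roomy S'].
Proof.
move=> pc sc; have k0 : 0 < k by apply: leq_trans lt_k.
have cS := card_setC_ord S.
have [lt1|le1] := ltnP #|S| m1.
  have [|S1 sub1 card1] := @subset_of_card m2 (~: S); first by lia.
  have [|d r sd] := split_shrink ltNA _ sub1 k0 pc (splitC sc).
    by rewrite card1.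
  exists d, (~: S1); split=> //; first by rewrite -(setCK A); apply: splitC.
  by have := card_setC_ord S1; rewrite /roomy; lia.
have [lt2|le2] := ltnP #|~: S| m2.
  have [S1 sub1 card1] := subset_of_card le1.
  have [|d r sd] := split_shrink ltA _ sub1 k0 pc sc; first by rewrite card1.
  by exists d, S1; split=> //; rewrite /roomy; lia.
exists c, S; split=> //; [exact: reach_refl | by rewrite /roomy; lia].
Qed.

End Connect.

(** * Reaching a split coloring *)

Section Unmix.

Variable A : {set T}.

Definition same_side_pairs : {set T * T} :=
  [set p | e p.1 p.2 && ((p.1 \in A) == (p.2 \in A))].

Lemma degsum_same_side : degsum A + degsum (~: A) = #|same_side_pairs|.
Proof.
rewrite -sum1_card.
transitivity (\sum_x \sum_(y | e x y && ((x \in A) == (y \in A))) 1).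
  rewrite [RHS](bigID (mem A)) /=; congr (_ + _).
    apply: eq_bigr => x xA; rewrite sum1_card; apply: eq_card => y.
    by rewrite inE unfold_in /= xA andbC; case: (y \in A).
  rewrite /degsum; apply: eq_big => [x|x]; first by rewrite inE.
  rewrite inE => /negPf xA; rewrite sum1_card; apply: eq_card => y.
  by rewrite !inE unfold_in /= xA andbC; case: (y \in A).
by rewrite pair_big_dep /=; apply: eq_bigl => p; rewrite inE.
Qed.

Definition seen X c : {set 'I_k} := [set c x | x in X].

(** A color weighs 0, 1 or 3 according as it occurs on no side, on one or on
    both.  With these values, every useful sorting step lowers the total:
    separating two colors leaves weight at most 2, against 3 or more for any
    pair with a mixed color, and merging two colors of the same side saves 1. *)
Definition weight c h : nat :=
  (h \in seen A c) + (h \in seen (~: A) c)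
    + (h \in seen A c) * (h \in seen (~: A) c).

Definition clashing c i j :=
  [exists p in same_side_pairs, (c p.1 == i) && (c p.2 == j)].

(** Swapping i and j on this set gives color i to the vertices of A colored i or
    j, and color j to those of ~A. *)
Definition sorting_set c i j : {set T} :=
  [set x | if x \in A then c x == j else c x == i].

(** An edge between a vertex of the set and one outside it, both colored i or j,
    would be monochromatic if it crossed the bipartition, and would join i and j
    on one side otherwise. *)
Lemma sorting_closed c i j : proper_on setT c -> ~~ clashing c i j ->
  kempe_closed setT c i j (sorting_set c i j).
Proof.
move=> pc; rewrite negb_exists_in => /forall_inP noij.
have nocl x y : e x y -> (x \in A) = (y \in A) -> c x = i -> c y = j -> false.
  move=> exy xy cx cy; have := noij (x, y); rewrite inE /= exy xy cx cy !eqxx.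
  by apply.
split=> [|x y]; first exact: subsetT.
rewrite !inE => xK _ exy x2 y2; have := pc x y (in_setT _) (in_setT _) exy.
apply: contraTT; rewrite negbK; case: ifP xK => xA /eqP cx.
  case: ifP => yA => yK; last by move: y2; rewrite (negPf yK) cx eq_sym.
  have cy : c y = i by apply/eqP; rewrite (negPf yK) orbF in y2.
  have := nocl y x; rewrite e_sym exy xA yA cx cy.
  by move/(_ erefl erefl erefl erefl).
case: ifP => yA => yK; first by move: y2; rewrite (negPf yK) orbF cx eq_sym.
have cy : c y = j by apply/eqP; move: y2; rewrite (negPf yK).
have := nocl x y; rewrite exy xA yA cx cy.
by move/(_ erefl erefl erefl erefl).
Qed.

Lemma sortedE c i j x : swap c i j (sorting_set c i j) x =
  if x \in two_colored c i j then (if x \in A then i else j) else c x.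
Proof.
rewrite swapE !inE; case: (x \in A).
  have [->|nj] := eqVneq (c x) j; first by rewrite orbT tpermR.
  by rewrite orbF; case: eqVneq.
have [->|ni] := eqVneq (c x) i; first by rewrite tpermL.
by case: eqVneq.
Qed.

Lemma seen_sortedA c i j h : h \in seen A (swap c i j (sorting_set c i j)) ->
  if h == i then (i \in seen A c) || (j \in seen A c)
  else (h != j) && (h \in seen A c).
Proof.
case/imsetP=> x xA; rewrite sortedE xA inE.
have cA : c x \in seen A c by apply: imset_f.
case: eqVneq cA => [-> cA ->|ni cA]; first by rewrite eqxx cA.
case: eqVneq cA => [-> cA ->|nj cA ->]; first by rewrite eqxx cA orbT.
by rewrite (negPf ni) nj cA.
Qed.

Lemma seen_sortedN c i j h :
  h \in seen (~: A) (swap c i j (sorting_set c i j)) ->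
  if h == j then (i \in seen (~: A) c) || (j \in seen (~: A) c)
  else (h != i) && (h \in seen (~: A) c).
Proof.
case/imsetP=> x xNA; have cA : c x \in seen (~: A) c by apply: imset_f.
rewrite sortedE; rewrite in_setC in xNA; rewrite (negPf xNA) inE.
case: eqVneq cA => [-> cA ->|ni cA]; first by rewrite eqxx cA.
case: eqVneq cA => [-> cA ->|nj cA ->]; first by rewrite eqxx cA orbT.
by rewrite (negPf nj) ni cA.
Qed.

Lemma weight_sorted c i j : i != j ->
  ((i \in seen A c) || (j \in seen A c))
    + ((i \in seen (~: A) c) || (j \in seen (~: A) c))
    < weight c i + weight c j ->
  \sum_h weight (swap c i j (sorting_set c i j)) h < \sum_h weight c h.
Proof.
move=> ij lt_w; have ji : j != i by rewrite eq_sym.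
rewrite (bigD1 i) //= (bigD1 j) //= addnA.
rewrite [ltnRHS](bigD1 i) //= [X in _ < _ + X](bigD1 j) //= addnA.
set d := swap _ _ _ _.
have sA := @seen_sortedA c i j; have sN := @seen_sortedN c i j.
rewrite -addSn; apply: leq_add.
  apply: leq_trans lt_w; rewrite ltnS /weight.
  have /negPf-> : j \notin seen A d.
    by apply/negP=> /sA; rewrite eqxx (negPf ji).
  have /negPf-> : i \notin seen (~: A) d.
    by apply/negP=> /sN; rewrite eqxx (negPf ij).
  rewrite muln0 mul0n !addn0 add0n; apply: leq_add.
    by case: (i \in seen A d) (sA i) => //; rewrite eqxx => ->.
  by case: (j \in seen _ d) (sN j) => //; rewrite eqxx => ->.
apply: leq_sum => h /andP[hi hj]; rewrite /weight.
have leA : (h \in seen A d) <= (h \in seen A c).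
  case: (h \in seen A d) (sA h) => //.
  by rewrite (negPf hi) => /(_ isT)/andP[_ ->].
have leN : (h \in seen (~: A) d) <= (h \in seen (~: A) c).
  case: (h \in seen _ d) (sN h) => //.
  by rewrite (negPf hj) => /(_ isT)/andP[_ ->].
by rewrite !leq_add // leq_mul.
Qed.

Definition few_same_side :=
  #|same_side_pairs| < 2 * ('C(uphalf k, 2) + 'C(k./2, 2)).

(** As long as some color h is mixed, a useful pair of colors exists.  An unused
    color can be paired with h.  If all colors are used, only the pairs of
    an A-only and a ~A-only color are useless; counting ordered pairs, there are
    too few same-side edges to block the k (k - 1) - 2 s1 s2 others. *)
Lemma sorting_pair c h : few_same_side ->
  h \in seen A c -> h \in seen (~: A) c ->
  exists i j, [/\ i != j, ~~ clashing c i j &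
    ((i \in seen A c) || (j \in seen A c))
      + ((i \in seen (~: A) c) || (j \in seen (~: A) c))
      < weight c i + weight c j].
Proof.
move=> few hA hN; rewrite /weight.
have [/existsP[j /andP[jA jN]]|noE] :=
  boolP [exists j, (j \notin seen A c) && (j \notin seen (~: A) c)].
  exists h, j; split; first by apply: contraNneq jA => <-.
    apply/exists_inP=> -[p _ /andP[_ /eqP cp]].
    have [pA|pA] := boolP (p.2 \in A).
      by rewrite -cp imset_f in jA.
    by rewrite -cp imset_f ?in_setC in jN.
  by rewrite hA hN (negPf jA) (negPf jN).
(* All colors being used, O1 and O2 are the A-only and the ~A-only ones. *)
pose O1 := ~: seen (~: A) c; pose O2 := ~: seen A c.
pose P := [set p : 'I_k * 'I_k | [&& p.1 != p.2,
  ~~ ((p.1 \in O1) && (p.2 \in O2)) & ~~ ((p.1 \in O2) && (p.2 \in O1))]].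
have [/subsetP allP|/subsetPn[[i j]]] :=
  boolP (P \subset [set (c p.1, c p.2) | p in same_side_pairs]).
  have leP : #|P| <= #|same_side_pairs|.
    apply: leq_trans (leq_imset_card (fun p => (c p.1, c p.2)) _).
    by apply/subset_leq_card/subsetP.
  have leO : #|O1| + #|O2| <= k.
    rewrite -[leqRHS](card_setC_ord O2) addnC leq_add2l.
    apply/subset_leq_card/subsetP=> i; rewrite !inE negbK => iN.
    move: noE; rewrite negb_exists => /forallP/(_ i).
    by rewrite iN andbT negbK.
  have := balanced_product leO.
  suff : k * k <= #|P| + (k + (#|O1| * #|O2| + #|O2| * #|O1|)).
    have := pairs_halves k; move: few.
    rewrite /few_same_side sum_bin2_halves (mulnC #|O2|).
    rewrite -[k.-1]subn1 mulnBr muln1.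
    by move: (uphalf k * _) (_.-1 * _) (#|O1| * _) (k * k) => B C x kk; lia.
  pose diag := [set (i, i) | i : 'I_k].
  have card_diag : #|diag| = k.
    by rewrite card_imset ?card_ord // => i j [].
  have cover : [set: 'I_k * 'I_k] \subset
      P :|: (diag :|: (setX O1 O2 :|: setX O2 O1)).
    apply/subsetP=> -[i j] _; rewrite in_setU in_setU in_setU !in_setX inE /=.
    have [<-|_] := eqVneq i j.
      by rewrite (imset_f (fun i => (i, i))) ?orbT.
    by case: ((i \in O1) && _); case: ((i \in O2) && _); rewrite ?orbT.
  have := subset_leq_card cover; rewrite cardsT card_prod card_ord => le_cover.
  rewrite (leq_trans le_cover) // (leq_trans (leq_card_setU _ _)) // leq_add2l.
  rewrite (leq_trans (leq_card_setU _ _)) // card_diag leq_add2l -!cardsX.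
  exact: leq_card_setU.
rewrite !inE /= => /and3P[ij n12 n21] noij; exists i, j; split=> //.
  apply: contra noij => /exists_inP[p pI /andP[/eqP<- /eqP<-]].
  by apply/imsetP; exists p.
move: noE; rewrite negb_exists => /forallP noE.
move: (noE i) (noE j) n12 n21.
by do 4 case: (_ \in seen _ _).
Qed.

Lemma reach_some_split c : few_same_side -> proper_on setT c ->
  exists d S, reach setT setT c d /\ split A S d.
Proof.
move=> few; have [n] := ubnP (\sum_h weight c h).
elim: n => // n IH in c *; rewrite ltnS => len pc.
have [/set0Pn[h]|] := boolP (seen A c :&: seen (~: A) c != set0).
  case/setIP=> hA hN; have [i [j [ij noij gain]]] := sorting_pair few hA hN.
  have clK := sorting_closed pc noij.
  have lt_w := weight_sorted ij gain.
  have [//||d [S [r sd]]] := IH (swap c i j (sorting_set c i j)).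
  - exact: leq_trans lt_w len.
  - exact: swap_proper.
  by exists d, S; split=> //; apply: reach_swap clK r; rewrite inE.
rewrite negbK => /eqP dis; exists c, (seen A c); split; first exact: reach_refl.
move=> x; have [xA|xA] := boolP (x \in A); first exact: imset_f.
apply/negP=> xsA; suff : c x \in seen A c :&: seen (~: A) c by rewrite dis inE.
by rewrite in_setI xsA imset_f ?in_setC.
Qed.

(** No same-side edge of e belongs to b, so there are at most l of them, and
    each is counted as two ordered pairs. *)
Lemma same_side_pairs_le (b : rel T) l :
  (forall x y, b x y -> (x \in A) != (y \in A)) -> subrel b e ->
  #|edges e| = #|edges b| + l -> #|same_side_pairs| <= l * 2.
Proof.
move=> bA be card_e; pose f (p : T * T) := [set p.1; p.2].
have lef : #|f @: same_side_pairs| <= l.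
  have sub_b : edges b \subset edges e.
    apply/subsetP=> _ /imsetP[p pb ->]; apply: imset_f.
    by move: pb; rewrite !inE; apply: be.
  rewrite -(leq_add2l #|edges b|) -card_e -leq_subRL ?subset_leq_card //.
  rewrite -{1}(setIidPr sub_b) -cardsD.
  apply/subset_leq_card/subsetP=> _ /imsetP[p pI ->].
  move: pI; rewrite inE => /andP[ep sp]; rewrite inE andbC imset_f ?inE //=.
  apply/negP=> /imsetP[q]; rewrite inE => /bA bq /setP fpq.
  have in_p z : z \in f q -> (z \in A) = (p.1 \in A).
    by rewrite -fpq !inE => /orP[]/eqP-> //; rewrite (eqP sp).
  by move: bq; rewrite !in_p ?eqxx // !inE eqxx ?orbT.
apply: leq_trans (leq_mul lef (leqnn 2)).
rewrite -sum1_card (partition_big_imset f) /= -sum_nat_const.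
apply: leq_sum => _ /imsetP[p pI ->]; rewrite sum1_card.
apply: leq_trans (_ : #|[set p; (p.2, p.1)]| <= 2); last first.
  by rewrite cards2; case: (_ == _).
apply/subset_leq_card/subsetP=> -[u v]; rewrite unfold_in /=.
case/andP=> uvI /eqP/setP fE.
have uv : u != v.
  by apply: contraTneq uvI => ->; rewrite inE /= e_irr.
have /set2P up : u \in f p by rewrite -fE !inE eqxx.
have /set2P vp : v \in f p by rewrite -fE !inE eqxx orbT.
case: p {pI fE} up vp => x y /= up vp; move: uv; rewrite !inE !xpair_eqE /=.
by case: up => ->; case: vp => ->; rewrite !eqxx ?orbT.
Qed.

End Unmix.

(** * All colorings are equivalent *)

Lemma windows_fit A m1 m2 : few_same_side A ->
  m1 * m1.-1 <= degsum A -> m2 * m2.-1 <= degsum (~: A) -> m1 + m2 < k.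
Proof.
move=> few le1 le2; rewrite ltnNge; apply/negP=> /balanced_minimum.
rewrite leqNgt => /negP[]; apply: leq_ltn_trans few.
by rewrite -degsum_same_side leq_add.
Qed.

Lemma reach_all (A : {set T}) c c' : few_same_side A ->
  proper_on setT c -> proper_on setT c' -> reach setT setT c c'.
Proof.
move=> few pc pc'.
have [m1 /andP[le1 lt1]] := triangular_window (degsum A).
have [m2 /andP[le2 lt2]] := triangular_window (degsum (~: A)).
have ltk := windows_fit few le1 le2.
have to_roomy d : proper_on setT d -> exists d' S,
    [/\ reach setT setT d d', split A S d' & roomy m1 m2 S].
  move=> pd; have [d1 [S [r1 s1]]] := reach_some_split few pd.
  have [d2 [S2 [r2 s2 g2]]] := split_roomy lt1 lt2 ltk (reach_proper r1 pd) s1.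
  by exists d2, S2; split=> //; apply: reach_trans r1 r2.
have [d [S [r s g]]] := to_roomy _ pc.
have [d' [S' [r' s' g']]] := to_roomy _ pc'.
apply: reach_trans (r) (reach_trans _ (reach_sym (r'))).
have pd := reach_proper r pc; have pd' := reach_proper r' pc'.
exact: (roomy_connect lt1 lt2 ltk g g' pd s pd' s').
Qed.

Lemma proper_exists (A : {set T}) : few_same_side A -> 0 < k ->
  exists c, proper_on setT c.
Proof.
move=> few k0.
have [m1 /andP[le1 lt1]] := triangular_window (degsum A).
have [m2 /andP[le2 lt2]] := triangular_window (degsum (~: A)).
have ltk := windows_fit few le1 le2.
have [|S _ cardS] := @subset_of_card m1 setT.
  by rewrite cardsT card_ord; lia.
have gS : roomy m1 m2 S by rewrite /roomy cardS leqnn ltnW.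
by have [c [pc _ _]] := split_coloring lt1 lt2 ltk (subxx S) gS gS; exists c.
Qed.

End KempeChanges.

Lemma Kc_eq1 (T : finType) (e : rel T) (k : nat) :
  (exists c : {ffun T -> 'I_k}, proper_coloring e c) ->
  (forall c d : coloring e k, kempe_equiv c d) -> Kc e k = 1.
Proof.
case=> c pc all_equiv.
rewrite /Kc (_ : equivalence_partition _ _ = [set [set: coloring e k]]).
  exact: cards1.
have block x : [set y in [set: coloring e k] | kempe_equiv x y] = setT.
  by apply/setP=> y; rewrite !inE all_equiv.
apply/setP=> B; rewrite inE; apply/imsetP/eqP=> [[x _ ->]|->].
  exact: block.
by exists (Sub c pc); rewrite ?inE ?block.
Qed.

Theorem theorem2 (k : nat) (hk : 0 < k) :
  (('C(uphalf k, 2) + 'C(k./2, 2))%:R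
     = ((k%:R) ^+ 2 - 2 * k%:R + (odd k)%:R) / 4 :> rat)%R
  /\ forall (T : finType) (e : rel T) (l : nat),
       simple_graph e -> BplusE l e ->
       l < 'C(uphalf k, 2) + 'C(k./2, 2) ->
       Kc e k = 1.
Proof.
split=> [|T e l [e_sym e_irr] [b [_ [A bA] be card_e]] lt_l].
  rewrite sum_bin2_halves.
  have : 4 * ((uphalf k).-1 * k./2) + 2 * k = k * k + odd k.
    rewrite uphalf_half; have := odd_double_half k; rewrite -muln2.
    move: (k./2) => h; case: (odd k) => /= <-; first by rewrite add1n /=; lia.
    by rewrite !add0n; case: h => [|h] //=; lia.
  move/(congr1 (fun n => n%:R : rat)%R).
  move: (_ * _./2) => m; rewrite !GRing.natrD !GRing.natrM => E.
  by rewrite GRing.expr2; lra.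
have few : few_same_side e k A.
  by have := same_side_pairs_le e_irr bA be card_e; rewrite /few_same_side; lia.
apply: Kc_eq1 => [|c d].
  by have [c /proper_onT pc] := proper_exists e_sym e_irr few hk; exists c.
apply: reach_kempe => //.
by apply: reach_all few _ _ => //; apply/proper_onT/valP.
Qed.
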